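(* Let $\lambda,\mu,\zeta,\sigma_z^2,P_T>0$ and $p_{ch}=\mathbb{Q}\big(\sqrt{\zeta P_T/\sigma_z^2}\big)$. Consider an error-correcting code with $k$ information bits and blocklength $n$, transmitted over a channel with Channel Model $(\zeta,\sigma_z^2)$ (a binary symmetric channel with crossover probability $p_{ch}$), and decoded by a fixed-message-length computation on a decoder circuit $\mathrm{DecCkt}$ implemented in Implementation Model $(\lambda,\mu)$, achieving block-error probability $P_e^{blk}$. If $$\log\frac{1}{10P_e^{blk}}>50\log\frac{1}{2p_{ch}},$$ then the bit-meters expended by the decoder satisfy $$\text{bit-meters}(\mathrm{DecCkt})\ \ge\ \frac{k}{48\sqrt2}\sqrt{\frac{\log\frac{1}{10P_e^{blk}}}{\log\frac{1}{2p_{ch}}}}\;\lambda .$$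
   Context: Channel Model $(\zeta,\sigma_z^2)$: $k$ i.i.d. fair bits $b_1,\dots,b_k$ are mapped by an encoder to a binary codeword $X_1^n\in\{0,1\}^n$, with $R=k/n$. The codeword is sent by BPSK with transmit power $P_T$ over an AWGN channel with path loss $\zeta$ and noise variance $\sigma_z^2$, and the receiver makes a hard decision on each symbol. The resulting channel $X_1^n\to Y_1^n$ is a memoryless binary symmetric channel with crossover probability $p_{ch}=\mathbb{Q}(\sqrt{\zeta P_T/\sigma_z^2})$, where $\mathbb{Q}(x)=\int_x^\infty \frac{1}{\sqrt{2\pi}}e^{-t^2/2}dt$. The decoder computes $\hat b_1^k$ from $Y_1^n$, and $P_e^{blk}=\Pr(\hat b_1^k\ne b_1^k)$. Implementation Model $(\lambda,\mu)$: The substrate is a square $\mathrm{Sq}(l)$ in $\mathbb{R}^2$ with vertices $(0,0),(0,l),(l,0),(l,l)$. A circuit $\mathrm{Ckt}=(\mathrm{Sq}(l),\mathcal S)$ is the substrate together with a set $\mathcal S$ of computational nodes, where $\mathcal S\subset \mathrm{Sq}(l)\cap\{(s\lambda,t\lambda):s,t\in\mathbb Z\}$. Nodes are input nodes (each stores one bit of the input of the computation at the start), output nodes (each stores one bit of the output at the end), or helper nodes. Between any ordered pair of nodes there is a noiseless unidirectional link, which may be used any number of times. Messages are binary strings. The order of the messages is predetermined, and each message is a function of all messages (and the input bit, if any) received or stored so far at the transmitting node. The output stored at an output node is a function of what that node has stored and received. In a fixed-message-length computation, the length of every message is predetermined (independent of the input). For a decoder circuit, the $n$ input nodes store $Y_1,\dots,Y_n$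 and the $k$ output nodes (''bit-nodes'') store $\hat b_1,\dots,\hat b_k$ at the end. Bit-meters: the bit-meters of a link are the total number of bits carried on it during the computation times the Euclidean distance between its two end nodes. The bit-meters of a circuit are the sum over all links. The energy of the computation is $\mu$ times its bit-meters. *)

(* Defs.v *)
From HB Require Import structures.
From mathcomp Require Import all_boot all_order all_algebra finmap.
From mathcomp Require Import all_classical all_reals all_analysis.

Set Implicit Arguments.
Unset Strict Implicit.
Unset Printing Implicit Defensive.

Import Order.TTheory GRing.Theory Num.Theory.
Import numFieldNormedType.Exports.

Local Open Scope classical_set_scope.
Local Open Scope ring_scope.

Definition Qfun {R : realType} (x : R) : R :=
  \int[@lebesgue_measure R]_(t in `[x, +oo[)
    ((Num.sqrt (2 * pi))^-1 * expR (- (t ^+ 2) / 2)).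

Definition crossover {R : realType} (zeta sigma2 PT : R) : R :=
  Qfun (Num.sqrt (zeta * PT / sigma2)).

(* Probability that the memoryless BSC(p) outputs y on input x. *)
Definition bsc {R : realType} (p : R) (n : nat) (x y : n.-tuple bool) : R :=
  \prod_(i < n) (if tnth y i == tnth x i then 1 - p else p).

(* The message is uniform on {0,1}^k (i.i.d. fair bits). *)
Definition block_error {R : realType} (p : R) (n k : nat)
    (enc : k.-tuple bool -> n.-tuple bool)
    (dec : n.-tuple bool -> k.-tuple bool) : R :=
  \sum_(b : k.-tuple bool)
    (2 ^+ k)^-1 * \sum_(y : n.-tuple bool | dec y != b) bsc p (enc b) y.

Definition Sq {R : realType} (l : R) : set (R * R) :=
  [set p | 0 <= p.1 <= l /\ 0 <= p.2 <= l].

Definition lattice {R : realType} (lambda : R) : set (R * R) :=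
  [set p | exists s t : int, p = (s%:~R * lambda, t%:~R * lambda)].

(* The norm the library puts on R * R is the sup norm, hence this definition. *)
Definition euclid_dist {R : realType} (u v : R * R) : R :=
  Num.sqrt ((u.1 - v.1) ^+ 2 + (u.2 - v.2) ^+ 2).

Record circuit (R : realType) (lambda : R) := Circuit {
  side : R;
  side_gt0 : 0 < side;
  nodes : {fset R * R};
  nodes_sub : [set` nodes] `<=` Sq side `&` lattice lambda
}.

(* One use of the link src -> dst.  The content of the message is a function of
   the input bit stored at src (if any) and of the list of all messages that
   src has received so far, in order of arrival. Since the order of the
   messages is predetermined, rules are allowed to depend on the time, and
   messages previously sent by src need not be extra arguments. *)
Record transmission (V : finType) := Transmission {
  src : V;
  dst : V;
  rule : option bool -> seq (seq bool) -> seq bool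
}.

(* Input bits sit at distinct nodes, and so do output bits; a node may hold both
   an input bit and an output bit. All other nodes are helper nodes. *)
Record computation (R : realType) (lambda : R) (C : circuit lambda)
    (n k : nat) := Computation {
  in_node : 'I_n -> nodes C;
  in_node_inj : injective in_node;
  out_node : 'I_k -> nodes C;
  out_node_inj : injective out_node;
  schedule : seq (transmission (nodes C));
  out_rule : 'I_k -> option bool -> seq (seq bool) -> bool
}.

Definition input_bit (R : realType) (lambda : R) (C : circuit lambda)
    (n k : nat) (D : computation C n k) (y : n.-tuple bool) (v : nodes C) :
    option bool :=
  omap (tnth y) [pick i | in_node D i == v].

(* A transcript entry (u, v, m) records a message m carried from u to v. *)
Definition inbox (V : finType) (v : V) (tr : seq (V * V * seq bool)) :
    seq (seq bool) :=
  [seq e.2 | e <- tr & e.1.2 == v].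

Definition transcript (R : realType) (lambda : R) (C : circuit lambda)
    (n k : nat) (D : computation C n k) (y : n.-tuple bool) :
    seq (nodes C * nodes C * seq bool) :=
  foldl (fun tr s =>
           rcons tr (src s, dst s,
                     rule s (input_bit D y (src s)) (inbox (src s) tr)))
        [::] (schedule D).

Definition decoder_map (R : realType) (lambda : R) (C : circuit lambda)
    (n k : nat) (D : computation C n k) (y : n.-tuple bool) : k.-tuple bool :=
  [tuple out_rule D i (input_bit D y (out_node D i))
                      (inbox (out_node D i) (transcript D y)) | i < k].

Definition fixed_message_length (R : realType) (lambda : R)
    (C : circuit lambda) (n k : nat) (D : computation C n k) : Prop :=
  exists len : seq nat,
    forall y : n.-tuple bool, [seq size e.2 | e <- transcript D y] = len.

Definition link_bits (R : realType) (lambda : R) (C : circuit lambda)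
    (n k : nat) (D : computation C n k) (y : n.-tuple bool) (u v : nodes C) :
    nat :=
  (\sum_(e <- transcript D y | e.1 == (u, v)) size e.2)%N.

Definition link_bit_meters (R : realType) (lambda : R) (C : circuit lambda)
    (n k : nat) (D : computation C n k) (y : n.-tuple bool) (u v : nodes C) :
    R :=
  (link_bits D y u v)%:R * euclid_dist (fsval u) (fsval v).

(* Bit-meters of the run on input y; for a fixed-message-length computation
   they do not depend on y. *)
Definition bit_meters (R : realType) (lambda : R) (C : circuit lambda)
    (n k : nat) (D : computation C n k) (y : n.-tuple bool) : R :=
  \sum_(u : nodes C) \sum_(v : nodes C) link_bit_meters D y u v.

(* Main.v *)
(* Write L for the ratio of logarithms and m for the integer part of sqrt L.
   Let S be a set of nodes with at most m^2 <= L input nodes.  A BSC(p) symbol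
   is, with probability 2p, replaced by a fair coin, so with probability at
   least (2p)^(m^2) everything S reads from the channel is noise.  If moreover
   fewer bits entered S than S has output nodes, those outputs would be wrong
   half of the time, which contradicts the size of Pe.  So at least as many bits
   enter S as S has output nodes.  Apply this to all translates of an m x m
   lattice window: every output node lies in m^2 of them, whereas a message
   travelling distance d enters at most m sqrt 2 d / lambda of them.  Summing over
   the translates gives bit-meters >= m k lambda / sqrt 2. *)

Require Import Defs.
From mathcomp Require Import all_boot all_order all_algebra finmap.
From mathcomp Require Import all_classical all_reals all_analysis.
From mathcomp Require Import measurable_realfun.
From mathcomp Require Import ring lra zify.

Set Implicit Arguments.
Unset Strict Implicit.
Unset Printing Implicit Defensive.

Import Order.TTheory GRing.Theory Num.Theory.
Import numFieldNormedType.Exports.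

Local Open Scope ring_scope.

(** * Noise and guessing on a binary symmetric channel *)

Definition agree_on n (T : {set 'I_n}) (y z : n.-tuple bool) :=
  [forall i in T, tnth y i == tnth z i].

(** Zeroing the coordinates outside [T] picks one representative in each class of words that agree
    on [T]; [supported T] collects these representatives. *)
Definition restr n (T : {set 'I_n}) (y : n.-tuple bool) : n.-tuple bool :=
  [tuple (i \in T) && tnth y i | i < n].

Definition supported n (T : {set 'I_n}) : {set n.-tuple bool} :=
  [set z | [forall i, tnth z i ==> (i \in T)]].

Lemma card_supported n (T : {set 'I_n}) : #|supported T| = (2 ^ #|T|)%N.
Proof.
rewrite -card_bool -(card_pffun_on false T predT).
rewrite -(card_imset _ (can_inj (@tuple_of_finfunK bool n))).
apply: eq_card => z; rewrite inE; apply/forallP/imsetP => [zT|[f + ->] i].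
  exists (finfun_of_tuple z); last by rewrite finfun_of_tupleK.
  apply/pffun_onP; split => //; apply/fintype.subsetP => i.
  rewrite unfold_in ffunE => zi.
  by have /implyP := zT i; apply; case: (tnth z i) zi.
move=> /pffun_onP[/fintype.subsetP fT _]; rewrite tnth_mktuple.
apply/implyP => fi; apply: fT; rewrite unfold_in.
by case: (f i) fi.
Qed.

Lemma restr_supported n (T : {set 'I_n}) y : restr T y \in supported T.
Proof.
by rewrite inE; apply/forallP => i; rewrite tnth_mktuple; apply/implyP => /andP[].
Qed.

Lemma restr_eq n (T : {set 'I_n}) y z : z \in supported T ->
  (restr T y == z) = agree_on T y z.
Proof.
rewrite inE => /forallP zT; apply/eqP/forall_inP => [<- i iT|yz].
  by rewrite tnth_mktuple iT.
apply: eq_from_tnth => i; rewrite tnth_mktuple.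
case: (boolP (i \in T)) => [/yz/eqP//|iT]; rewrite andFb.
by have := zT i; rewrite (negPf iT) implybF => /negPf ->.
Qed.

Lemma bsc_ge0 (R : realType) (p : R) n (x y : n.-tuple bool) :
  0 <= p <= 1 / 2 -> 0 <= bsc p x y.
Proof. by move=> p2; apply: prodr_ge0 => i _; case: ifP => _; lra. Qed.

(** The sum factors over the coordinates. One in [T] contributes [p] or [1 - p], both at least [p];
    a free one contributes 1. *)
Lemma bsc_cylinder (R : realType) (p : R) n (x z : n.-tuple bool)
    (T : {set 'I_n}) : 0 <= p <= 1 / 2 ->
  p ^+ #|T| <= \sum_(y : n.-tuple bool | agree_on T y z) bsc p x y.
Proof.
move=> p2; pose w i (c : bool) : R := if c == tnth x i then 1 - p else p.
pose Q i (c : bool) := (i \in T) ==> (c == tnth z i).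
have -> : \sum_(y : n.-tuple bool | agree_on T y z) bsc p x y =
          \prod_(i < n) \sum_(c | Q i c) w i c.
  rewrite bigA_distr_big_dep (reindex (@tuple_of_finfun bool n)) /=; last first.
    exists (@finfun_of_tuple bool n) => f _;
      [exact: tuple_of_finfunK | exact: finfun_of_tupleK].
  apply: eq_big => [f|f _].
    apply/forall_inP/familyP => H i; have := H i; rewrite tnth_mktuple /Q unfold_in.
      by move=> h; apply/implyP => /h.
    by move=> /implyP.
  by apply: eq_bigr => i _; rewrite tnth_mktuple.
have -> : p ^+ #|T| = \prod_(i < n) (if i \in T then p else 1).
  by rewrite -big_mkcond /= prodr_const.
apply: ler_prod => i _; case: (boolP (i \in T)) => iT.
  rewrite (eq_bigl (pred1 (tnth z i))) => [|c]; last by rewrite /Q iT.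
  by rewrite big_pred1_eq /w; case: ifP => _; lra.
rewrite (eq_bigl predT) => [|c]; last by rewrite /Q (negPf iT).
by rewrite big_bool /w; case: (tnth x i) => /=; lra.
Qed.

(** For a fixed pattern [z] on [T], a reachable [b] is recovered from two data: the message of one
    word reaching it, which fixes [b] on [K], and the part of [b] outside [K]. The bound counts such
    pairs. *)
Lemma card_reachable n k (dec : n.-tuple bool -> k.-tuple bool)
    (T : {set 'I_n}) (K : {set 'I_k}) (M : finType) (msg : n.-tuple bool -> M)
    (z : n.-tuple bool) :
  (forall y y', agree_on T y y' -> msg y = msg y' ->
     agree_on K (dec y) (dec y')) ->
  (#|[set b | [exists y, agree_on T y z && agree_on K (dec y) b]]|
     <= #|M| * 2 ^ #|~: K|)%N.
Proof.
move=> det; set A := [set b | _].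
pose y_ b := odflt z [pick y | agree_on T y z && agree_on K (dec y) b].
have y_P b : b \in A -> agree_on T (y_ b) z && agree_on K (dec (y_ b)) b.
  rewrite inE /y_; case: pickP => //= none /existsP[y].
  by rewrite none.
pose f b := (msg (y_ b), restr (~: K) b).
have f_inj : {in A &, injective f}.
  move=> b b' /y_P/andP[/forall_inP bT /forall_inP bK].
  move=> /y_P/andP[/forall_inP b'T /forall_inP b'K] /pair_equal_spec[emsg eres].
  have /forall_inP decK : agree_on K (dec (y_ b)) (dec (y_ b')).
    apply: det => //; apply/forall_inP => i iT.
    by rewrite (eqP (bT _ iT)) (eqP (b'T _ iT)).
  apply: eq_from_tnth => i; case: (boolP (i \in K)) => iK.
    by rewrite -(eqP (bK _ iK)) -(eqP (b'K _ iK)); apply/eqP/decK.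
  have := congr1 (fun t => tnth t i) eres.
  by rewrite !tnth_mktuple inE iK.
rewrite -(card_in_imset f_inj) -card_supported -cardsT -cardsX.
apply/subset_leq_card/fintype.subsetP => _ /imsetP[b _ ->].
by rewrite inE /= inE restr_supported.
Qed.

(* With probability at least [(2p)^|T|] the symbols received on [T] are pure
   noise, and then the [K]-part of the output is guessed from [msg] alone. *)
Lemma block_error_ge (R : realType) (p : R) n k
    (enc : k.-tuple bool -> n.-tuple bool) (dec : n.-tuple bool -> k.-tuple bool)
    (T : {set 'I_n}) (K : {set 'I_k}) (M : finType) (msg : n.-tuple bool -> M) :
  0 <= p <= 1 / 2 ->
  (forall y y', agree_on T y y' -> msg y = msg y' ->
     agree_on K (dec y) (dec y')) ->
  (2 * #|M| <= 2 ^ #|K|)%N ->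
  (2 * p) ^+ #|T| / 2 <= block_error p enc dec.
Proof.
move=> p2 det Mle.
pose reach z := [set b | [exists y, agree_on T y z && agree_on K (dec y) b]].
(* Whatever pattern is received on [T], at least half of the [2 ^ k] messages are unreachable. *)
have reachP z : (2 ^ k <= 2 * #|~: reach z|)%N.
  have := card_reachable z det; rewrite -/(reach z) => rz.
  have : (2 * #|reach z| <= 2 ^ k)%N.
    rewrite -[X in (_ <= _ ^ X)%N]card_ord -(cardsC K) expnD.
    apply: leq_trans (leq_mul Mle (leqnn _)).
    by rewrite -mulnA leq_mul2l.
  by have := cardsC (reach z); rewrite card_tuple card_bool; lia.
(* Received words are grouped by their pattern on [T]. If [b] is unreachable from [z], every word of
   that group is decoded wrongly, and the group has probability at least [p ^+ #|T|]. *)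
have step b : \sum_(z in supported T) (if b \notin reach z then p ^+ #|T| else 0) <=
    \sum_(y | dec y != b) bsc p (enc b) y.
  rewrite [leRHS](partition_big (restr T) (mem (supported T))) => [|y _] /=; last first.
    exact: restr_supported.
  apply: ler_sum => z zT.
  case: ifP => [nreach|_]; last first.
    by apply: sumr_ge0 => y _; exact: bsc_ge0.
  apply: le_trans (bsc_cylinder (enc b) z T p2) _.
  rewrite le_eqVlt; apply/orP; left; apply/eqP/eq_bigl => y.
  rewrite (restr_eq _ zT); case: (boolP (agree_on T y z)) => yz; last first.
    by rewrite andbF.
  rewrite andbT; apply/esym; apply: contraNneq nreach => <-.
  rewrite inE; apply/existsP; exists y; rewrite yz.
  by apply/forall_inP.
rewrite /block_error -mulr_sumr.
apply: le_trans (ler_wpM2l _ (ler_sum _ (fun b _ => step b))); last first.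
  by rewrite invr_ge0 exprn_ge0.
rewrite exchange_big /=.
(* With the sums exchanged, each of the [2 ^ #|T|] patterns spoils at least [2 ^ k / 2] messages,
   whence the factor [(2 * p) ^+ #|T| / 2]. *)
have bnd : \sum_(z in supported T) 2 ^+ k / 2 * p ^+ #|T| <=
    \sum_(z in supported T) \sum_b (if b \notin reach z then p ^+ #|T| else 0).
  apply: ler_sum => z zT; rewrite -big_mkcond.
  rewrite (eq_bigl (mem (~: reach z))) => [|b]; last by rewrite /= !inE.
  rewrite sumr_const -[leRHS]mulr_natl ler_wpM2r//.
    by rewrite exprn_ge0//; case/andP: p2.
  by rewrite ler_pdivrMr// mulrC -natrM -natrX ler_nat reachP.
apply: le_trans (ler_wpM2l _ bnd); last by rewrite invr_ge0 exprn_ge0.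
rewrite sumr_const card_supported -[X in _ <= _ * X]mulr_natl natrX exprMn.
have : (2 ^+ k : R) != 0 by rewrite expf_neq0// pnatr_eq0.
by move=> k0; rewrite le_eqVlt; apply/orP; left; apply/eqP; field.
Qed.

(** * Information crossing a cut of a computation *)

Definition crosses (V : finType) (S : {set V}) (uv : V * V) :=
  (uv.1 \notin S) && (uv.2 \in S).

Definition cut_messages (V : finType) (S : {set V})
    (tr : seq (V * V * seq bool)) : seq (seq bool) :=
  [seq e.2 | e <- tr & crosses S e.1].

Definition cut_bits (V : finType) (S : {set V})
    (tr : seq (V * V * seq bool)) : nat :=
  (\sum_(e <- tr | crosses S e.1) size e.2)%N.

(** This is [transcript] with the input assignment and the schedule abstracted, so that induction on
    the schedule is possible. *)
Definition run (V : finType) (inp : V -> option bool)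
    (s : seq (transmission V)) : seq (V * V * seq bool) :=
  foldl (fun tr t =>
           rcons tr (src t, dst t, rule t (inp (src t)) (inbox (src t) tr)))
        [::] s.

Lemma run_rcons (V : finType) (inp : V -> option bool) s (t : transmission V) :
  run inp (rcons s t) = rcons (run inp s)
    (src t, dst t, rule t (inp (src t)) (inbox (src t) (run inp s))).
Proof. by rewrite /run foldl_rcons. Qed.

Lemma run_links (V : finType) (inp : V -> option bool) s :
  [seq e.1 | e <- run inp s] = [seq (src t, dst t) | t <- s].
Proof.
by elim/last_ind: s => [//|s t IH]; rewrite run_rcons !map_rcons IH.
Qed.

Lemma inbox_filter (V : finType) (S : {set V}) v tr : v \in S ->
  inbox v tr = inbox v [seq e <- tr | e.1.2 \in S].
Proof.
move=> vS; rewrite /inbox -filter_predI; congr map; apply: eq_filter => e /=.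
by case: eqP => //= ->.
Qed.

(** Induction on the schedule: a message received in [S] either comes from outside, and is then
    listed in [cut_messages], or is computed in [S] from inputs and earlier messages already known
    to agree. *)
Lemma run_cut (V : finType) (S : {set V}) (inp inp' : V -> option bool) s :
  {in S, inp =1 inp'} ->
  cut_messages S (run inp s) = cut_messages S (run inp' s) ->
  [seq e <- run inp s | e.1.2 \in S] = [seq e <- run inp' s | e.1.2 \in S].
Proof.
move=> eqi; elim/last_ind: s => [//|s t IH].
rewrite /cut_messages !run_rcons !filter_rcons /= /crosses /=.
case: (boolP (dst t \in S)) => dS; rewrite ?andbF ?andbT; last exact: IH.
case: (boolP (src t \in S)) => sS /=.
  move=> /IH eqs; rewrite eqs; congr (rcons _ (_, _, rule _ _ _)).
    exact: eqi.
  by rewrite (inbox_filter _ sS) eqs -inbox_filter.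
by rewrite !map_rcons => /rcons_inj[/IH -> ->].
Qed.

(** Fixed links and lengths fix where each crossing message begins and ends, so the concatenated
    bits determine the messages. *)
Lemma shape_cut_messages (V : finType) (S : {set V})
    (tr tr' : seq (V * V * seq bool)) :
  [seq e.1 | e <- tr] = [seq e.1 | e <- tr'] ->
  [seq size e.2 | e <- tr] = [seq size e.2 | e <- tr'] ->
  shape (cut_messages S tr) = shape (cut_messages S tr').
Proof.
elim: tr tr' => [|e tr IH] [|e' tr'] //= [e1 tr1] [e2 tr2].
have := IH _ tr1 tr2; rewrite /cut_messages /= e1.
by case: ifP => //= _; rewrite e2 => ->.
Qed.

Lemma sumn_shape_cut (V : finType) (S : {set V})
    (tr : seq (V * V * seq bool)) :
  sumn (shape (cut_messages S tr)) = cut_bits S tr.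
Proof. by rewrite /cut_bits -big_filter sumnE /shape !big_map. Qed.

Section Cut.
Variables (R : realType) (lambda : R) (C : circuit lambda) (n k : nat).
Variables (D : computation C n k) (S : {set nodes C}).

Definition cut_inputs : {set 'I_n} := [set i | in_node D i \in S].
Definition cut_outputs : {set 'I_k} := [set j | out_node D j \in S].

Lemma decoder_map_cut (y y' : n.-tuple bool) : agree_on cut_inputs y y' ->
  cut_messages S (transcript D y) = cut_messages S (transcript D y') ->
  agree_on cut_outputs (decoder_map D y) (decoder_map D y').
Proof.
move=> /forall_inP yT eqm.
have inpE : {in S, input_bit D y =1 input_bit D y'}.
  move=> v vS; rewrite /input_bit; case: pickP => //= i /eqP iv.
  by congr Some; apply/eqP/yT; rewrite inE iv.
apply/forall_inP => j; rewrite inE => jS; rewrite !tnth_mktuple inpE//.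
have := run_cut inpE eqm; rewrite -!/(transcript _ _) => eqS.
by rewrite (inbox_filter _ jS) eqS -inbox_filter.
Qed.

(** By contraposition: if [B] bits cross and [B] is less than the number of outputs in [S], then
    [2 * 2 ^ B] is at most the number of output patterns, and [block_error_ge] applies with the
    crossing bits as [msg]. *)
Lemma cut_bits_ge (p : R) (enc : k.-tuple bool -> n.-tuple bool)
    (y : n.-tuple bool) :
  fixed_message_length D -> 0 <= p <= 1 / 2 ->
  block_error p enc (decoder_map D) < (2 * p) ^+ #|cut_inputs| / 2 ->
  (#|cut_outputs| <= cut_bits S (transcript D y))%N.
Proof.
move=> [len fixed] p2; rewrite ltNge; apply: contraR; rewrite -ltnNge => Blt.
set B := cut_bits S (transcript D y) in Blt.
have shapeE y' y'' : shape (cut_messages S (transcript D y')) =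
    shape (cut_messages S (transcript D y'')).
  by apply: shape_cut_messages; rewrite ?fixed// [LHS]run_links [RHS]run_links.
pose bits y' := flatten (cut_messages S (transcript D y')).
have bits_size y' : size (bits y') == B.
  by rewrite /B -sumn_shape_cut (shapeE y y') size_flatten.
pose msg y' : B.-tuple bool := Tuple (bits_size y').
apply: (block_error_ge (msg := msg) enc p2) => [y' y'' yT [eqb]|].
  by apply: decoder_map_cut => //; exact: eq_from_flatten_shape eqb (shapeE _ _).
by rewrite card_tuple card_bool -expnS leq_exp2l.
Qed.

End Cut.

(** * Counting the translates of a square window *)

Definition slide m x a := (x < a <= x + m)%N.

(** The indices [a] and [b] are the exclusive upper ends: the window is the product of [a - m, a)
    and [b - m, b). Translates overhanging the origin thus keep natural indices. *)
Definition window (V : finType) (X Y : V -> nat) m a b : {set V} :=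
  [set v | slide m (X v) a && slide m (Y v) b].

Definition l1_dist (V : Type) (X Y : V -> nat) (u v : V) : nat :=
  ((X u - X v + (X v - X u)) + (Y u - Y v + (Y v - Y u)))%N.

Lemma sum_interval N l u :
  (\sum_(a < N.+1) (l < a <= u) = minn N u - l)%N.
Proof.
elim: N => [|N IH]; first by rewrite big_ord_recl big_ord0 /= min0n.
by rewrite big_ord_recr /= IH; case: (ltnP l N.+1); case: (ltnP N u); lia.
Qed.

Lemma sum_slide N m x : (x + m <= N)%N -> (\sum_(a < N.+1) slide m x a = m)%N.
Proof. by move=> xmN; rewrite sum_interval; lia. Qed.

(** The indices admitting [x] and those admitting [x'] form two intervals of length [m], shifted by
    the distance from [x] to [x']. *)
Lemma sum_slide_diff N m x x' :
  (\sum_(a < N) (slide m x a && ~~ slide m x' a) <= x' - x + (x - x'))%N.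
Proof.
case: N => [|N]; first by rewrite big_ord0.
case: (leqP x' x) => xx'.
  apply: (@leq_trans (\sum_(a < N.+1) (x' + m < a <= x + m))%N).
    by apply: leq_sum => a _; rewrite /slide; lia.
  by rewrite sum_interval; lia.
apply: (@leq_trans (\sum_(a < N.+1) (x < a <= x'))%N).
  by apply: leq_sum => a _; rewrite /slide; lia.
by rewrite sum_interval; lia.
Qed.

(** Offsets from the lower corner embed the window in an [m] by [m] grid. *)
Lemma card_window (V : finType) (X Y : V -> nat) m a b :
  injective (fun v => (X v, Y v)) ->
  (#|window X Y m a b| <= m * m)%N.
Proof.
move=> XYinj; case: m => [|m'].
  by rewrite eq_card0// => v; rewrite !inE; apply/negbTE; rewrite /slide; lia.
rewrite -[X in (_ <= X * X)%N]card_ord -card_prod.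
pose f v : 'I_m'.+1 * 'I_m'.+1 := (inord (X v + m'.+1 - a), inord (Y v + m'.+1 - b)).
apply: (@leq_card_in _ _ f) => u v; rewrite !inE /slide => uW vW [].
move=> /(congr1 val) eX /(congr1 val) eY; move: eX eY.
by rewrite /= !inordK; [move=> eX eY; apply: XYinj; congr pair| | | |]; lia.
Qed.

Section Windows.
Variables (V : finType) (X Y : V -> nat) (m N : nat).
Hypothesis XN : forall v, (X v + m <= N)%N.
Hypothesis YN : forall v, (Y v + m <= N)%N.

Lemma sum_window v :
  (\sum_(a < N.+1) \sum_(b < N.+1) (v \in window X Y m a b) = m * m)%N.
Proof.
rewrite -[X in (_ = X * _)%N](sum_slide (XN v)) -[X in (_ = _ * X)%N](sum_slide (YN v)).
rewrite big_distrlr /=; apply: eq_bigr => a _; apply: eq_bigr => b _.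
by rewrite inE mulnb.
Qed.

(** If [v] is inside and [u] outside, they are separated in the first or in the second coordinate.
    Each case leaves [m] positions for the other coordinate of the window. *)
Lemma sum_window_crosses u v :
  (\sum_(a < N.+1) \sum_(b < N.+1) crosses (window X Y m a b) (u, v)
     <= m * l1_dist X Y u v)%N.
Proof.
pose dif Z (a : 'I_N.+1) := slide m (Z v) a && ~~ slide m (Z u) a.
apply: (@leq_trans (\sum_(a < N.+1) \sum_(b < N.+1) dif X a * slide m (Y v) b +
    \sum_(a < N.+1) \sum_(b < N.+1) slide m (X v) a * dif Y b)%N).
  rewrite -big_split /=; apply: leq_sum => a _.
  rewrite -big_split /=; apply: leq_sum => b _.
  rewrite /crosses !inE /dif /=.
  by case: (slide m (X v) a); case: (slide m (X u) a);
    case: (slide m (Y v) b); case: (slide m (Y u) b).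
rewrite -!big_distrlr /= !sum_slide// /l1_dist mulnDr.
apply: leq_add; last by rewrite leq_mul2l [X in _ || X]sum_slide_diff orbT.
by rewrite mulnC leq_mul2l [X in _ || X]sum_slide_diff orbT.
Qed.

End Windows.

(** * From lattice counts to Euclidean bit-meters *)

Section Geometry.
Variables (R : realType) (lambda : R) (C : circuit lambda) (n k : nat).
Variable D : computation C n k.

Lemma bit_metersE (y : n.-tuple bool) :
  bit_meters D y = \sum_(e <- transcript D y)
    (size e.2)%:R * euclid_dist (fsval e.1.1) (fsval e.1.2).
Proof.
rewrite /bit_meters pair_big /=.
under eq_bigr => uv _ do
  rewrite /link_bit_meters /link_bits natr_sum mulr_suml -surjective_pairing.
rewrite (exchange_big_dep predT) //=; apply: eq_bigr => e _.
rewrite (eq_bigl (pred1 e.1)) => [|uv]; last by rewrite /= eq_sym.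
by rewrite big_pred1_eq.
Qed.

(** The substrate lies in the nonnegative quadrant, so the integer coordinates are natural
    numbers. *)
Lemma lattice_coordinates : 0 < lambda ->
  {XY : nodes C -> nat * nat |
    forall v, fsval v = ((XY v).1%:R * lambda, (XY v).2%:R * lambda)}.
Proof.
move=> lambda_gt0.
suff /choice[XY XYP] : forall v : nodes C, exists xy : nat * nat,
    fsval v = (xy.1%:R * lambda, xy.2%:R * lambda) by exists XY.
move=> v; have [[x0 y0] [s [t]]] := nodes_sub (valP v).
move: x0 y0; rewrite /= => /andP[x0 _] /andP[y0 _] vE.
move: x0 y0; rewrite vE /= !pmulr_lge0// !ler0z.
by case: s {vE} => // s; case: t => // t _ _; exists (s, t).
Qed.

(** Cauchy-Schwarz in the plane, in the form [(|dx| - |dy|) ^+ 2 >= 0]. *)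
Lemma l1_dist_le (X Y : nodes C -> nat) : 0 < lambda ->
  (forall v, fsval v = ((X v)%:R * lambda, (Y v)%:R * lambda)) ->
  forall u v, (l1_dist X Y u v)%:R * lambda <=
    Num.sqrt 2 * euclid_dist (fsval u) (fsval v).
Proof.
move=> lambda_gt0 XYE u v.
have natdist (i j : nat) : ((i - j + (j - i))%N%:R : R) = `|i%:R - j%:R|.
  case: (leqP i j) => ij.
    by rewrite (eqP ij) add0n natrB// ler0_norm ?opprB// subr_le0 ler_nat.
  have ji := ltnW ij.
  by rewrite (eqP ji) addn0 natrB// ger0_norm// subr_ge0 ler_nat.
rewrite /euclid_dist !XYE /= -sqrtrM// -!mulrBl !exprMn -mulrDl.
rewrite /l1_dist natrD !natdist.
set dx := _ - _; set dy := _ - _.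
have s0 : 0 <= (`|dx| + `|dy|) * lambda.
  by apply: mulr_ge0; [exact: addr_ge0 | exact: ltW].
rewrite -[leLHS]ger0_norm// -sqrtr_sqr ler_sqrt; last first.
  apply: mulr_ge0 => //; apply: mulr_ge0; last exact: sqr_ge0.
  by apply: addr_ge0; exact: sqr_ge0.
rewrite exprMn [leRHS]mulrA; apply: ler_wpM2r; first exact: sqr_ge0.
rewrite -[dx ^+ 2]real_normK ?num_real// -[dy ^+ 2]real_normK ?num_real//.
by have := sqr_ge0 (`|dx| - `|dy|); nra.
Qed.

(* Each output node lies in exactly [m * m] of the windows, while a link
   from [u] to [v] enters at most [m * l1_dist u v] of them. *)
Lemma bit_meters_ge (m : nat) (y : n.-tuple bool) : 0 < lambda -> (0 < m)%N ->
  (forall S : {set nodes C}, (#|cut_inputs D S| <= m * m)%N ->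
     (#|cut_outputs D S| <= cut_bits S (transcript D y))%N) ->
  (m * k)%:R * lambda <= Num.sqrt 2 * bit_meters D y.
Proof.
move=> lambda_gt0 m_gt0 cutP; have [XY XYE] := lattice_coordinates lambda_gt0.
pose X v := (XY v).1; pose Y v := (XY v).2.
have XYinj : injective (fun v => (X v, Y v)).
  by move=> u v [eX eY]; apply: val_inj; rewrite /= !XYE -/(X u) -/(Y u) eX eY.
(* Large enough that every translate containing a node has both indices at most [N]. *)
pose N := (\max_v X v + \max_v Y v + m)%N.
have XN v : (X v + m <= N)%N.
  by rewrite leq_add2r (leq_trans (leq_bigmax v))// leq_addr.
have YN v : (Y v + m <= N)%N.
  by rewrite leq_add2r (leq_trans (leq_bigmax v))// leq_addl.
pose tr := transcript D y.
have win a b : (#|cut_outputs D (window X Y m a b)| <=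
    cut_bits (window X Y m a b) tr)%N.
  (* Input bits sit at distinct nodes, so a window holds at most [m * m] of them. *)
  apply: cutP; rewrite -(card_imset _ (@in_node_inj _ _ _ _ _ D)).
  apply: leq_trans (card_window m a b XYinj).
  apply/subset_leq_card/fintype.subsetP => _ /imsetP[i + ->].
  by rewrite inE.
(* Double counting over all windows; one factor [m] is cancelled afterwards. *)
have total : (m * (m * k) <= m * \sum_(e <- tr) size e.2 * l1_dist X Y e.1.1 e.1.2)%N.
  have -> : (m * (m * k) = \sum_(a < N.+1) \sum_(b < N.+1)
      #|cut_outputs D (window X Y m a b)|)%N.
    under eq_bigr => a _ do under eq_bigr => b _ do rewrite -sum1_card big_mkcond.
    under eq_bigr => a _ do rewrite exchange_big.
    rewrite exchange_big /= (eq_bigr (fun=> (m * m)%N)) => [|j _].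
      by rewrite sum_nat_const card_ord; lia.
    rewrite -(sum_window XN YN (out_node D j)).
    apply: eq_bigr => a _; apply: eq_bigr => b _; rewrite inE.
    by case: (_ \in _).
  apply: (@leq_trans (\sum_(a < N.+1) \sum_(b < N.+1)
      cut_bits (window X Y m a b) tr)%N).
    by apply: leq_sum => a _; apply: leq_sum => b _; exact: win.
  rewrite big_distrr /=.
  under eq_bigr => a _ do under eq_bigr => b _ do rewrite /cut_bits big_mkcond.
  under eq_bigr => a _ do rewrite exchange_big.
  rewrite exchange_big /=; apply: leq_sum => -[[u v] s] _ /=.
  rewrite mulnCA.
  apply: leq_trans (leq_mul (leqnn _) (sum_window_crosses XN YN u v)).
  rewrite big_distrr /=; apply: leq_sum => a _.
  rewrite big_distrr /=; apply: leq_sum => b _.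
  by case: ifP => _; rewrite ?muln1 ?muln0.
move: total; rewrite leq_pmul2l// -(ler_nat R) => total.
apply: le_trans (ler_wpM2r (ltW lambda_gt0) total) _.
rewrite natr_sum bit_metersE mulr_suml mulr_sumr; apply: ler_sum => e _.
rewrite natrM -mulrA [leRHS]mulrCA ler_wpM2l//.
exact: l1_dist_le.
Qed.

End Geometry.

(** * Bounds on the Gaussian tail *)

Section GaussianTail.
Variable R : realType.
Local Notation mu := (@lebesgue_measure R).
Local Notation phi := (normal_pdf (0 : R) 1).

Let phiE t : phi t = (Num.sqrt (2 * pi))^-1 * expR (- (t ^+ 2) / 2).
Proof.
rewrite normal_pdfE ?oner_neq0// /normal_peak /normal_fun subr0 expr1n mul1r.
by rewrite mulr_natl.
Qed.

Let phi_gt0 t : 0 < phi t.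
Proof. by rewrite phiE mulr_gt0 ?expR_gt0// invr_gt0 sqrtr_gt0 mulr_gt0 ?pi_gt0. Qed.

Let integral_half : (\int[mu]_(t in `[0%R, +oo[) (phi t)%:E = (1 / 2)%:E)%E.
Proof.
have := integral_normal_pdf (0 : R) 1.
rewrite ge0_symfun_integralT; [|by move=> t; exact: ltW|
  by apply: continuous_normal_pdf; exact: oner_neq0|
  by move=> t /=; rewrite !phiE sqrrN].
rewrite -set_itvcy; set I := (\int[_]_(_ in _) _)%E => I2.
have : (0 <= I)%E by apply: integral_ge0 => t _; rewrite lee_fin ltW.
case: I I2 => [r| |] //; last by rewrite mulry gtr0_sg// mul1e.
by rewrite -EFinM => -[r2] _; congr EFin; lra.
Qed.

(** On nonnegative reals [phi] decreases, so it is at least [phi b] on the interval. *)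
Let integral_itv_gt0 (a b : R) : 0 <= a -> a < b ->
  (0 < \int[mu]_(t in `[a, b[) (phi t)%:E)%E.
Proof.
move=> a0 ab; apply: (@lt_le_trans _ _ (\int[mu]_(t in `[a, b[) (cst (phi b)%:E) t)%E).
  rewrite integral_cst//= lebesgue_measure_itv/= lte_fin ab -EFinD -EFinM lte_fin.
  by rewrite mulr_gt0// subr_gt0.
apply: ge0_le_integral => //.
- by move=> t _; rewrite lee_fin ltW.
- by apply/measurable_EFinP/measurable_funTS; exact: measurable_normal_pdf.
- move=> t /=; rewrite in_itv/= => /andP[at_ tb]; rewrite lee_fin !phiE.
  rewrite ler_pM2l ?invr_gt0 ?sqrtr_gt0 ?mulr_gt0 ?pi_gt0// ler_expR.
  by nra.
Qed.

Let integral_setU (a b : R) : a < b ->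
  (\int[mu]_(t in `[a, +oo[) (phi t)%:E =
   \int[mu]_(t in `[a, b[) (phi t)%:E + \int[mu]_(t in `[b, +oo[) (phi t)%:E)%E.
Proof.
move=> ab; rewrite (@itv_bndbnd_setU _ _ (BLeft a) (BLeft b))// ?bnd_simp ?ltW//.
rewrite ge0_integral_setU//=.
- rewrite -itv_bndbnd_setU ?bnd_simp ?ltW//.
  by apply/measurable_EFinP/measurable_funTS; exact: measurable_normal_pdf.
- by move=> t _; rewrite lee_fin ltW.
- apply/disj_setPLR => t /=; rewrite !in_itv/= andbT => /andP[_ tb] bt.
  by move: (lt_le_trans tb bt); rewrite ltxx.
Qed.

(** The mass on [x, x + 1) makes the tail positive; the mass on [0, x) keeps it strictly below the
    half-line total 1/2, which also rules out infinite integrals. *)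
Lemma Qfun_bounds (x : R) : 0 < x -> 0 < Qfun x < 1 / 2.
Proof.
move=> x0.
have QE : Qfun x = fine (\int[mu]_(t in `[x, +oo[) (phi t)%:E)%E.
  rewrite /Qfun /Rintegral; congr fine; apply: eq_integral => t _.
  by rewrite phiE.
rewrite QE; have := integral_itv_gt0 (lexx 0) x0.
have x1 : x < x + 1 by rewrite ltrDl.
have := integral_itv_gt0 (ltW x0) x1.
have := integral_setU x0; rewrite integral_half.
have := integral_setU x1.
have : (0 <= \int[mu]_(t in `[(x + 1)%R, +oo[) (phi t)%:E)%E.
  by apply: integral_ge0 => t _; rewrite lee_fin ltW.
case: (\int[mu]_(t in `[(x + 1)%R, +oo[) (phi t)%:E)%E => [r| |]//;
case: (\int[mu]_(t in `[x, (x + 1)%R[) (phi t)%:E)%E => [s| |]//;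
case: (\int[mu]_(t in `[x, +oo[) (phi t)%:E)%E => [u| |]//;
case: (\int[mu]_(t in `[0%R, x[) (phi t)%:E)%E => [v| |]//.
rewrite -!EFinD !lte_fin lee_fin => r0 [->] [e] s0 v0 /=.
by lra.
Qed.

End GaussianTail.

(** * Choice of the window side and comparison of logarithms *)

Theorem theorem1 (R : realType) (lambda mu zeta sigma2 PT : R)
    (lambda_gt0 : 0 < lambda) (mu_gt0 : 0 < mu) (zeta_gt0 : 0 < zeta)
    (sigma2_gt0 : 0 < sigma2) (PT_gt0 : 0 < PT)
    (n k : nat) (enc : k.-tuple bool -> n.-tuple bool)
    (C : circuit lambda) (DecCkt : computation C n k)
    (fixed : fixed_message_length DecCkt) :
  let p_ch := crossover zeta sigma2 PT in
  let Pe := block_error p_ch enc (decoder_map DecCkt) in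
  ln (1 / (10 * Pe)) > 50 * ln (1 / (2 * p_ch)) ->
  forall y : n.-tuple bool,
    bit_meters DecCkt y >=
      k%:R / (48 * Num.sqrt 2)
        * Num.sqrt (ln (1 / (10 * Pe)) / ln (1 / (2 * p_ch))) * lambda.
Proof.
move=> p Pe; have /andP[p0 p2] : 0 < p < 1 / 2.
  by apply: Qfun_bounds; rewrite sqrtr_gt0 divr_gt0 ?mulr_gt0.
have q0 : 0 < 1 / (2 * p) by rewrite divr_gt0 ?mulr_gt0.
have q1 : 1 < 1 / (2 * p) by rewrite ltr_pdivlMr ?mulr_gt0//; lra.
set a := ln (1 / (10 * Pe)); set l := ln (1 / (2 * p)) => la y.
have l0 : 0 < l by exact: ln_gt0.
(* Since [ln] is 0 at nonpositive arguments and [1 / 0] is 0, [Pe <= 0] would give [a = 0], against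
   [50 * l < a]. *)
have Pe0 : 0 < Pe.
  rewrite ltNge; apply/negP => Pe0; move: la; rewrite /a ln0; first by lra.
  by rewrite div1r invr_le0; lra.
set L := a / l.
have L50 : 50 < L by rewrite ltr_pdivlMr.
have aE : a = L * l by rewrite divfK// gt_eqF.
have s0 : 0 <= Num.sqrt L by exact: sqrtr_ge0.
have sE : Num.sqrt L ^+ 2 = L by rewrite sqr_sqrtr; lra.
pose m := Num.truncn (Num.sqrt L).
have /andP[ms sm] : m%:R <= Num.sqrt L < m.+1%:R by exact: truncn_itv.
have s1 : 1 <= Num.sqrt L by nra.
have m_gt0 : (0 < m)%N.
  by move: s1; rewrite ltnNge; apply: contraTN; case: (m) sm => // + _; lra.
have cutP (S : {set nodes C}) : (#|cut_inputs DecCkt S| <= m * m)%N ->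
    (#|cut_outputs DecCkt S| <= cut_bits S (transcript DecCkt y))%N.
  move=> Tm; apply: (cut_bits_ge (p := p) (enc := enc)) => //.
    by rewrite ltW//= ltW.
  rewrite -/Pe ltNge; apply/negP => Pege.
  have tm : (2 * p) ^+ (m * m) / 2 <= Pe.
    apply: le_trans Pege; rewrite ler_pM2r//.
    by apply: ler_wiXn2l => //; lra.
  (* From [t / 2 <= Pe] with [t = (2 * p) ^+ (m * m)], [10 * Pe >= 5 * t > t]. This yields
     [a < m * m * l], whereas [m * m <= L] and [a = L * l]. *)
  have : a < ln ((1 / (2 * p)) ^+ (m * m)).
    rewrite ltr_ln ?posrE ?exprn_gt0 ?divr_gt0 ?mulr_gt0//.
    rewrite !div1r exprVn ltf_pV2 ?posrE ?exprn_gt0 ?mulr_gt0//.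
    have : 0 < (2 * p) ^+ (m * m) by rewrite exprn_gt0 ?mulr_gt0.
    by move: tm; set t := _ ^+ _ => tm t0; clear -tm t0; lra.
  rewrite lnXn// -/l -[ltRHS]mulr_natl aE ltr_pM2r// natrM.
  by apply/negP; rewrite -leNgt -sE expr2 ler_pM.
have := bit_meters_ge lambda_gt0 m_gt0 cutP.
rewrite natrM; set B := bit_meters _ _ => main.
have r0 : 0 < Num.sqrt 2 :> R by rewrite sqrtr_gt0.
have -> : k%:R / (48 * Num.sqrt 2) * Num.sqrt L * lambda =
    (k%:R * Num.sqrt L * lambda / 48) / Num.sqrt 2.
  by field; rewrite gt_eqF.
rewrite ler_pdivrMr// [leRHS]mulrC; apply: le_trans main.
have -> : k%:R * Num.sqrt L * lambda / 48 = Num.sqrt L / 48 * k%:R * lambda by lra.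
apply: ler_wpM2r; first exact: ltW.
rewrite ler_wpM2r//.
(* From [1 <= m] and [Num.sqrt L < m + 1] follows [Num.sqrt L <= 48 * m]. *)
have : (1 : R) <= m%:R by rewrite ler1n.
by move: sm; rewrite -natr1; lra.
Qed.
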